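(* Let $\lambda,\mu\in\mathbb C$ with $\lambda^3\neq-27$ and $\mu^3\neq-27$. Let $E_1,E_2\subset\mathbb P^2$ be the smooth plane cubics \[ E_1:\ x_0^2x_1+x_1^2x_2+x_2^2x_0+\lambda x_0x_1x_2=0,\qquad E_2:\ z_0^2z_2+z_2^2z_1+z_1^2z_0+\mu z_0z_1z_2=0 . \] Assume that the elliptic curves $E_1$ and $E_2$ are non-isogenous. Let $A=E_1\times E_2$ and let \[ f\colon A\dashrightarrow\mathbb P^2,\qquad (x,z)\longmapsto[x_0z_0:x_1z_1:x_2z_2]. \] Then the field extension $\mathbb C(\mathbb P^2)\subset\mathbb C(A)$ induced by $f$ is not Galois.
   Context: All varieties are over $\mathbb C$. The plane cubics above are smooth exactly because $\lambda^3\neq-27$ and $\mu^3\neq-27$. Every complex elliptic curve is isomorphic to a smooth member of each of the two families, so every pair of non-isogenous complex elliptic curves can be presented as such a pair $E_1,E_2$. The map $f$ is dominant of degree $3$, so it induces a degree $3$ extension of function fields $\mathbb C(\mathbb P^2)\subset\mathbb C(A)$. *)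

(* Defs.v *)
From HB Require Import structures.
From mathcomp Require Import all_boot all_order all_algebra all_field.
From mathcomp Require Import reals complex.
From mathcomp Require Import mpoly.

Set Implicit Arguments.
Unset Strict Implicit.
Unset Printing Implicit Defensive.

Import Order.TTheory GRing.Theory Num.Theory.
Local Open Scope ring_scope.

(* A point of P^2 is represented by a nonzero row vector of homogeneous
   coordinates; two vectors represent the same point when they are [proj_eq]. *)
Definition proj_eq (F : fieldType) (n : nat) (u v : 'rV[F]_n) : Prop :=
  exists2 c : F, c != 0 & u = c *: v.

Definition cubic1 (F : fieldType) (lam : F) (x : 'rV[F]_3) : Prop :=
  x != 0 /\
  x 0 0 ^+ 2 * x 0 1 + x 0 1 ^+ 2 * x 0 2 + x 0 2 ^+ 2 * x 0 0
    + lam * x 0 0 * x 0 1 * x 0 2 = 0.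

Definition cubic2 (F : fieldType) (mu : F) (z : 'rV[F]_3) : Prop :=
  z != 0 /\
  z 0 0 ^+ 2 * z 0 2 + z 0 2 ^+ 2 * z 0 1 + z 0 1 ^+ 2 * z 0 0
    + mu * z 0 0 * z 0 1 * z 0 2 = 0.

Definition plane (F : fieldType) (y : 'rV[F]_3) : Prop := y != 0.

(* A pair of points of P^2 is stored as the concatenation of two vectors. *)
Definition product (F : fieldType) (X Y : 'rV[F]_3 -> Prop)
    (v : 'rV[F]_(3 + 3)) : Prop :=
  X (lsubmx v) /\ Y (rsubmx v).

Definition poly_map (F : fieldType) (g : 'I_3 -> {mpoly F[3]})
    (v : 'rV[F]_3) : 'rV[F]_3 :=
  \row_i (g i).@[v 0].

(* Morphisms between closed subsets of P^2, given on representatives: near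
   every point the map is given by homogeneous polynomials of one degree
   without common zero. *)
Definition is_morphism (F : fieldType) (X Y : 'rV[F]_3 -> Prop)
    (phi : 'rV[F]_3 -> 'rV[F]_3) : Prop :=
  (forall P, X P -> Y (phi P)) /\
  (forall P, X P -> exists (d : nat) (g : 'I_3 -> {mpoly F[3]}),
     [/\ forall i, g i \is d.-homog,
         poly_map g P != 0
       & forall Q, X Q -> poly_map g Q != 0 ->
           proj_eq (phi Q) (poly_map g Q)]).

(* Nonzero isogeny of elliptic curves (E, O) -> (E', O'). *)
Definition is_isogeny (F : fieldType) (E : 'rV[F]_3 -> Prop) (O : 'rV[F]_3)
    (E' : 'rV[F]_3 -> Prop) (O' : 'rV[F]_3)
    (phi : 'rV[F]_3 -> 'rV[F]_3) : Prop :=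
  [/\ is_morphism E E' phi,
      proj_eq (phi O) O'
    & exists2 P, E P & ~ proj_eq (phi P) O'].

(* The curves come without a distinguished origin; because of translations
   the choice of the origins O and O' is immaterial. *)
Definition isogenous (F : fieldType) (E E' : 'rV[F]_3 -> Prop) : Prop :=
  exists O O' phi, [/\ E O, E' O' & is_isogeny E O E' O' phi].

Definition is_homog (F : fieldType) (n d : nat) (p : {mpoly F[n]}) : Prop :=
  p \is d.-homog.

Definition is_bihomog (F : fieldType) (m n : nat) (de : nat * nat)
    (p : {mpoly F[m + n]}) : Prop :=
  forall mon, mon \in msupp p ->
    (\sum_(i < m) mon (lshift n i))%N = de.1 /\
    (\sum_(j < n) mon (rshift m j))%N = de.2.

(* [is_function_field h X iota g]: the field K, with structural embedding
   iota : F -> K, is the function field of the variety X, and g is a vector of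
   homogeneous coordinates in K of the generic point of X. Here [h d p] says
   that p is (multi)homogeneous of (multi)degree d. The two conditions say that
   p/q |-> p(g)/q(g) is a well-defined bijection onto K from the fractions of
   forms of equal degree with q not vanishing identically on X, modulo
   equality on X. *)
Definition is_function_field (F : fieldType) (n : nat) (D : Type)
    (h : D -> {mpoly F[n]} -> Prop) (X : 'rV[F]_n -> Prop)
    (K : fieldType) (iota : {rmorphism F -> K}) (g : 'rV[K]_n) : Prop :=
  (forall d p, h d p ->
     mmap iota (g 0) p = 0 <-> (forall v, X v -> p.@[v 0] = 0)) /\
  (forall a : K, exists d p q,
     [/\ h d p, h d q, mmap iota (g 0) q != 0
       & a = mmap iota (g 0) p / mmap iota (g 0) q]).

Definition coord_mul (F : fieldType) (v : 'rV[F]_(3 + 3)) : 'rV[F]_3 :=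
  \row_i (lsubmx v 0 i * rsubmx v 0 i).

(* The field embedding C(P^2) -> C(A) induced by f, (p/q) |-> (p/q) o f, where
   y and xz are the generic points of P^2 and of A. *)
Definition is_pullback (F K L : fieldType)
    (iotaK : {rmorphism F -> K}) (y : 'rV[K]_3)
    (iotaL : {rmorphism F -> L}) (xz : 'rV[L]_(3 + 3))
    (phi : {rmorphism K -> L}) : Prop :=
  forall (d : nat) (p q : {mpoly F[3]}),
    p \is d.-homog -> q \is d.-homog -> mmap iotaK (y 0) q != 0 ->
    phi (mmap iotaK (y 0) p / mmap iotaK (y 0) q) =
      mmap iotaL (coord_mul xz 0) p / mmap iotaL (coord_mul xz 0) q.

(* MathComp's [galois] lives inside a splitting field, hence presupposes
   normality of the ambient extension; these are the usual notions for an
   arbitrary field extension phi : K -> L. *)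
Definition algebraic_ext (K L : fieldType) (phi : {rmorphism K -> L}) : Prop :=
  forall a : L, algebraicOver phi a.

Definition separable_ext (K L : fieldType) (phi : {rmorphism K -> L}) : Prop :=
  algebraic_ext phi /\
  forall (a : L) (p : {poly K}),
    irreducible_poly p -> root (map_poly phi p) a -> separable_poly p.

Definition normal_ext (K L : fieldType) (phi : {rmorphism K -> L}) : Prop :=
  algebraic_ext phi /\
  forall (a : L) (p : {poly K}),
    irreducible_poly p -> root (map_poly phi p) a ->
    exists rs : seq L, map_poly phi p %= \prod_(r <- rs) ('X - r%:P).

Definition galois_ext (K L : fieldType) (phi : {rmorphism K -> L}) : Prop :=
  separable_ext phi /\ normal_ext phi.

(* Main.v *)
(** Put [s = y0/y2], [t = y1/y2] on P^2 and [u = z0/z2], [v = z1/z2] on E_2.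
    Over the point [(s, t)] the equations of the two curves become two cubics
    in [u, v]; eliminating [v] between them leaves an explicit cubic in [u] over
    C(s, t), irreducible by Eisenstein's criterion at [s = 0], and
    C(A) = C(P^2)(u).  If C(A)/C(P^2) is Galois, this cubic splits in C(A), so
    its discriminant becomes a square in a cubic extension of C(s, t), hence is
    one already in C(s, t) (take norms).
    Along two directions at infinity the leading part of the discriminant is, up
    to a square, [4 n X - 27 (X - 1)^2] with [n = mu^3], respectively
    [n = lam^3]; this quadratic polynomial has simple roots unless [n = 0] or
    [n = -27].  Hence [lam = mu = 0], and then exchanging two coordinates
    identifies the two curves. *)
Require Import Defs.
From HB Require Import structures.
From mathcomp Require Import all_boot all_order all_algebra all_field.
From mathcomp Require Import reals complex.
From mathcomp Require Import mpoly.
From mathcomp Require Import generic_quotient ring.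
From mathcomp Require boolp.

Set Implicit Arguments.
Unset Strict Implicit.
Unset Printing Implicit Defensive.

Import Order.TTheory GRing.Theory Num.Theory.
Local Open Scope ring_scope.

(** * Evaluation of multivariate polynomials *)

Section MmapFacts.

Variable n : nat.

Lemma eq_mmap (R S : nzRingType) (f f' : R -> S) (h h' : 'I_n -> S)
    (p : {mpoly R[n]}) :
  f =1 f' -> h =1 h' -> mmap f h p = mmap f' h' p.
Proof.
by move=> ff' hh'; apply: eq_bigr => m _; rewrite ff' (mmap1_eq _ hh').
Qed.

Lemma rmorph_mmap (R S T : nzRingType) (r : {rmorphism S -> T}) (f : R -> S)
    (h : 'I_n -> S) (p : {mpoly R[n]}) :
  r (mmap f h p) = mmap (r \o f) (r \o h) p.
Proof.
rewrite /mmap rmorph_sum; apply: eq_bigr => m _.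
rewrite rmorphM; congr (_ * _); rewrite /mmap1 rmorph_prod.
by apply: eq_bigr => i _; rewrite rmorphXn.
Qed.

Lemma mmap_homog_scale (R : nzRingType) (S : comNzRingType) (f : R -> S)
    (h : 'I_n -> S) (c : S) d (p : {mpoly R[n]}) :
  p \is d.-homog -> mmap f (fun i => c * h i) p = c ^+ d * mmap f h p.
Proof.
move=> /dhomogP hp; rewrite /mmap mulr_sumr; apply: eq_big_seq => m /hp <-.
rewrite mulrCA; congr (_ * _); rewrite /mmap1 /= mdegE -prodrXr -big_split.
by apply: eq_bigr => i _; rewrite exprMn.
Qed.

End MmapFacts.

(** * Roots, fractions in lowest terms at 0, and norms *)

Lemma poly_nat_roots_eq0 (D : idomainType) (p : {poly D}) :
  injective (fun k => k%:R : D) -> (forall k, p.[k%:R] = 0) -> p = 0.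
Proof.
move=> inj p0.
apply: (@roots_geq_poly_eq0 _ p [seq k%:R | k <- iota 0 (size p)]).
- by apply/allP => x /mapP [k _ ->]; apply/eqP.
- by rewrite map_inj_uniq ?iota_uniq.
- by rewrite size_map size_iota.
Qed.

Lemma fraction_numden (D : idomainType) (w : {fraction D}) :
  exists P Q : D, Q != 0 /\ w = tofrac P / tofrac Q.
Proof.
elim/quotW: w => x; exists \n_x, \d_x; split; first exact: denom_ratioP.
unlock FracField.tofrac.
rewrite -[X in _ = _ * X]FracField.pi_inv -[RHS]FracField.pi_mul.
rewrite /FracField.mulf /FracField.invf.
rewrite !numden_Ratio ?oner_eq0 ?denom_ratioP //.
by rewrite mulr1 mul1r Ratio_numden.
Qed.

(** Only the common power of ['X] is cancelled: [D] is an arbitrary domain, so gcds may fail to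
    exist, and evaluation at 0 sees no other common factor. *)
Lemma fraction_reduced (D : idomainType) (w : {fraction {poly D}}) :
  exists P Q : {poly D},
    [/\ Q != 0, w = tofrac P / tofrac Q & P.[0] = 0 -> Q.[0] != 0].
Proof.
have [P [Q [QN0 ->]]] := fraction_numden w.
have [->|PN0] := eqVneq P 0.
  by exists 0, 1; split; rewrite ?oner_eq0 ?rmorph0 ?mul0r // !hornerE oner_eq0.
have [m [P' + eP]] := multiplicity_XsubC P 0.
have [n [Q' + eQ]] := multiplicity_XsubC Q 0.
rewrite QN0 PN0 /= !subr0 /root in eP eQ * => Q'0 P'0.
have cancelX (F : fieldType) (a b c : F) : c != 0 -> (a * c) / (b * c) = a / b.
  by move=> cN0; rewrite -mulf_div divff ?mulr1.
have XN0 k : tofrac 'X^k != 0 :> {fraction {poly D}}.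
  by rewrite tofrac_eq0 expf_neq0 ?polyX_eq0.
have Q'N0 : Q' != 0 by apply: contraNneq Q'0 => ->; rewrite horner0.
rewrite eP eQ; case: (leqP m n) => [le_mn|/ltnW le_nm].
  exists P', (Q' * 'X^(n - m)); split; last by move=> e; rewrite e eqxx in P'0.
    by rewrite mulf_neq0 // expf_neq0 ?polyX_eq0.
  rewrite -{1}(subnK le_mn) exprD mulrA.
  by rewrite (rmorphM _ P') (rmorphM _ (_ * _)); exact: cancelX (XN0 _).
exists (P' * 'X^(m - n)), Q'; split=> //.
rewrite -{1}(subnK le_nm) exprD mulrA.
by rewrite (rmorphM _ (_ * _)) (rmorphM _ Q'); exact: cancelX (XN0 _).
Qed.

(* [b] is the norm of the square root [p] of [a] in [K[X]/(c)]. *)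
Lemma sqr_eq_expn_of_dvdp (K : fieldType) (c p : {poly K}) (a : K) n :
  size c = n.+2 -> c %| p ^+ 2 - a%:P -> exists b, b ^+ 2 = a ^+ n.+1.
Proof.
move=> szc; have cN0 : c != 0 by rewrite -size_poly_gt0 szc.
pose c' := (lead_coef c)^-1 *: c.
have lcN0 : (lead_coef c)^-1 != 0 by rewrite invr_eq0 lead_coef_eq0.
have mc : c' \is monic by rewrite monicE lead_coefZ mulVf ?lead_coef_eq0.
rewrite -(dvdpZl _ _ lcN0) -/c'.
(* The companion matrix of [c'] has size [(size c').-1], equal to [n.+1] only up to rewriting, so it
   is abstracted to a matrix [A] of the right type. *)
have [A eA] : exists A : 'M[K]_n.+1, char_poly A = c'.
  have : n.+1 = (size c').-1 by rewrite size_scale ?szc.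
  move=> e; move: (companionmx c') (companionmxK mc).
  by rewrite -e => A; exists A.
rewrite -eA => /dvdpP [q eq_q].
have: horner_mx A (p ^+ 2 - a%:P) = 0.
  by rewrite eq_q rmorphM /= Cayley_Hamilton mulr0.
rewrite rmorphB rmorphXn /= horner_mx_C => /subr0_eq e.
(* The square of [p] at [A] is the scalar matrix [a] of size [n.+1]; determinants give the power
   [a ^+ n.+1]. *)
exists (\det (horner_mx A p)).
by rewrite expr2 -det_mulmx [_ *m _]e det_scalar.
Qed.

(** * Embeddings of function fields and specialization of the plane *)

(** Every element of [K] is a quotient of forms of equal degree at [y]. Since the same forms vanish
    at [w] and at [y], the relation [T] sending such a quotient to its value at [w] is
    single-valued, total and compatible with the operations; choice turns it into a ring
    morphism. *)
Lemma function_field_embedding (C K F : fieldType) n (X : 'rV[C]_n -> Prop)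
    (iota : {rmorphism C -> K}) (y : 'rV[K]_n)
    (hK : is_function_field (@is_homog C n) X iota y)
    (j : {rmorphism C -> F}) (w : 'rV[F]_n)
    (hw : forall d p, p \is d.-homog ->
       mmap j (w 0) p = 0 <-> mmap iota (y 0) p = 0) :
  exists theta : {rmorphism K -> F}, forall d p q,
    p \is d.-homog -> q \is d.-homog -> mmap iota (y 0) q != 0 ->
    theta (mmap iota (y 0) p / mmap iota (y 0) q)
      = mmap j (w 0) p / mmap j (w 0) q.
Proof.
case: hK => _ frac.
have eq0 d p : p \is d.-homog ->
    (mmap j (w 0) p == 0) = (mmap iota (y 0) p == 0).
  by move=> hp; apply/eqP/eqP; case: (hw d p hp).
pose T a f := exists d p q, [/\ p \is d.-homog /\ q \is d.-homog,
  mmap iota (y 0) q != 0, a = mmap iota (y 0) p / mmap iota (y 0) q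
  & f = mmap j (w 0) p / mmap j (w 0) q].
have Tuniq a f f' : T a f -> T a f' -> f = f'.
  move=> [d [p [q [[hp hq] qN0 -> ->]]]] [d' [p' [q' [[hp' hq'] q'N0 + ->]]]].
  move/eqP; rewrite eqr_div // -!rmorphM -subr_eq0 -rmorphB -(@eq0 (d + d')%N).
    rewrite rmorphB !rmorphM subr_eq0 => /eqP e.
    by apply/eqP; rewrite eqr_div ?(eq0 _ _ hq) ?(eq0 _ _ hq') // e.
  by apply: rpredB; [|rewrite addnC]; apply: dhomogM.
have Tadd a b f h : T a f -> T b h -> T (a + b) (f + h).
  move=> [d [p [q [[hp hq] qN0 -> ->]]]] [d' [p' [q' [[hp' hq'] q'N0 -> ->]]]].
  exists (d + d')%N, (p * q' + p' * q), (q * q'); split.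
  - split; last exact: dhomogM.
    by apply: rpredD; [|rewrite addnC]; apply: dhomogM.
  - by rewrite rmorphM mulf_neq0.
  - by rewrite rmorphD !rmorphM addf_div.
  - by rewrite rmorphD !rmorphM addf_div ?(eq0 _ _ hq) ?(eq0 _ _ hq').
have Tmul a b f h : T a f -> T b h -> T (a * b) (f * h).
  move=> [d [p [q [[hp hq] qN0 -> ->]]]] [d' [p' [q' [[hp' hq'] q'N0 -> ->]]]].
  exists (d + d')%N, (p * p'), (q * q'); split.
  - by split; apply: dhomogM.
  - by rewrite rmorphM mulf_neq0.
  - by rewrite !rmorphM mulf_div.
  - by rewrite !rmorphM mulf_div.
have T1 : T 1 1.
  exists 0%N, 1, 1; rewrite !rmorph1 !divr1 oner_eq0; split=> //.
  by rewrite dhomog1.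
have Ttot a : exists f, T a f.
  have [d [p [q [hp hq qN0 ->]]]] := frac a.
  by exists (mmap j (w 0) p / mmap j (w 0) q), d, p, q.
pose th a := projT1 (boolp.cid (Ttot a)).
have thP a : T a (th a) by rewrite /th; case: boolp.cid.
have thE a f : T a f -> th a = f by exact: Tuniq (thP a).
have thD : {morph th : a b / a + b} by move=> a b; apply/thE/Tadd.
have th0 : th 0 = 0 by apply: (addrI (th 0)); rewrite -thD !addr0.
have thB : zmod_morphism th.
  move=> a b; apply: (addIr (th b)); rewrite -thD subrK.
  by rewrite addrNK.
have thM : monoid_morphism th.
  by split; [apply: thE | move=> a b; apply/thE/Tmul].
pose theta : {rmorphism K -> F} := HB.pack th
  (GRing.isZmodMorphism.Build K F th thB)
  (GRing.isMonoidMorphism.Build K F th thM).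
by exists theta => d p q hp hq qN0; apply: thE; exists d, p, q.
Qed.

(** The outer variable ['X] takes the value [r] and the inner variable ['X%:P] the value [x]. Later
    the outer variable is the local parameter that is set to 0. *)
Definition bipoly_eval (C : comNzRingType) (x r : C) : {poly {poly C}} -> C :=
  horner_eval x \o horner_eval r%:P.

HB.instance Definition _ (C : comNzRingType) (x r : C) :=
  GRing.RMorphism.on (bipoly_eval x r).

Lemma bipoly_eval_mmap (C : comNzRingType) n (g : 'I_n -> {poly {poly C}})
    (p : {mpoly C[n]}) (x r : C) :
  bipoly_eval x r (mmap (polyC \o polyC) g p)
    = p.@[fun i => bipoly_eval x r (g i)].
Proof.
have key (ev : {rmorphism {poly {poly C}} -> C}) :
    (forall a, ev a%:P%:P = a) ->
    ev (mmap (polyC \o polyC) g p) = p.@[fun i => ev (g i)].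
  by move=> evC; rewrite rmorph_mmap; apply: eq_mmap => [a|//]; apply: evC.
apply: (key (bipoly_eval x r)) => a.
by rewrite /= /bipoly_eval /= /horner_eval !hornerC.
Qed.

Lemma bipoly_eq0 (C : numDomainType) (q : {poly {poly C}}) :
  (forall x r, bipoly_eval x r q = 0) -> q = 0.
Proof.
move=> q0; apply: poly_nat_roots_eq0 => [k l e | k].
  have /(congr1 (coefp 0)) : k%:R = l%:R :> {poly C} by [].
  by rewrite /= -!polyC_natr !coefC /=; move/(mulrIn (oner_neq0 _)).
apply: poly_nat_roots_eq0 => [? ? /(mulrIn (oner_neq0 _)) // | l].
by rewrite -polyC_natr; apply: (q0 l%:R k%:R).
Qed.

(* [hg] says that the rational map [g] to the plane is dominant. *)
Lemma plane_specialization (C : numFieldType) (K : fieldType)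
    (iota : {rmorphism C -> K}) (y : 'rV[K]_3)
    (hK : is_function_field (@is_homog C 3) (@plane C) iota y)
    (g : 'I_3 -> {poly {poly C}})
    (hg : forall v : 'I_3 -> C, (forall i, v i != 0) -> exists x r c : C,
       c != 0 /\ forall i, bipoly_eval x r (g i) = c * v i) :
  exists theta : {rmorphism K -> {fraction {poly {poly C}}}},
    (forall a, theta (iota a) = tofrac a%:P%:P) /\
    (forall i k, theta (y 0 i / y 0 k) = tofrac (g i) / tofrac (g k)).
Proof.
have vanish := hK.1.
have homX i : ('X_i : {mpoly C[3]}) \is 1.-homog by rewrite dhomogX /= mdeg1.
have yN0 i : y 0 i != 0.
  apply/eqP; have := vanish 1%N 'X_i (homX i); rewrite mmapX mmap1U => -[+ _].
  move=> h /h /(_ (const_mx 1)); rewrite mevalXU mxE => e.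
  have: (1 : C) = 0; last by apply/eqP; rewrite oner_eq0.
  by apply: e; apply/eqP => /matrixP /(_ 0 0) /eqP; rewrite !mxE oner_eq0.
have gN0 i : g i != 0.
  have [x [r [c [cN0 /(_ i) e]]]] := hg (fun=> 1) (fun=> oner_neq0 _).
  by apply: contraNneq cN0 => gi0; rewrite -[c]mulr1 -e gi0 rmorph0.
pose j : {rmorphism C -> {fraction {poly {poly C}}}} :=
  @tofrac _ \o polyC \o polyC.
pose G p := mmap (polyC \o polyC : {rmorphism C -> {poly {poly C}}}) g p.
have mmapE p : mmap j ((\row_i tofrac (g i)) 0) p = tofrac (G p).
  by rewrite rmorph_mmap; apply: eq_mmap => // i; rewrite mxE.
have evG x r p : bipoly_eval x r (G p) = p.@[fun i => bipoly_eval x r (g i)].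
  exact: bipoly_eval_mmap.
have [|theta thetaE] :=
  @function_field_embedding _ _ _ _ _ _ _ hK j (\row_i tofrac (g i)).
  move=> d p hp; rewrite mmapE; split=> [/eqP|p0].
    rewrite tofrac_eq0 => /eqP Gp0.
    (* [hg] reaches only the points with all coordinates nonzero; the factor [\prod_i 'X_i] makes
       the form vanish at all the others. *)
    pose q := p * \prod_i 'X_i.
    have q0 : mmap iota (y 0) q = 0.
      apply/(vanish (d + \sum_(i < 3) 1)%N).
        apply: dhomogM => //; rewrite !big_ord_recl !big_ord0.
        by do ?[exact: dhomogM]; do ?apply: dhomogM; rewrite ?homX ?dhomog1.
      move=> v _; rewrite rmorphM rmorph_prod /=.
      have [[i vi0]|vN0] := boolp.pselect (exists i, v 0 i = 0).
        by rewrite (bigD1 i) //= mevalXU vi0 mul0r mulr0.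
      have [|x [r [c [cN0 e]]]] := hg (v 0).
        by move=> i; apply/eqP => vi0; apply: vN0; exists i.
      have := evG x r p; rewrite Gp0 rmorph0 /meval.
      rewrite (@eq_mmap _ _ _ _ idfun _ (fun i => c * v 0 i)) //.
      rewrite (mmap_homog_scale _ _ _ hp) => /esym/eqP.
      by rewrite mulf_eq0 expf_eq0 (negPf cN0) andbF => /eqP ->; rewrite mul0r.
    move/eqP: q0; rewrite rmorphM rmorph_prod mulf_eq0 => /orP [/eqP //|].
    by move=> /prodf_eq0 [i _] /=; rewrite mmapX mmap1U (negPf (yN0 i)).
  move/(vanish d p hp) in p0; apply/eqP; rewrite tofrac_eq0.
  (* Where [g 0] vanishes, the vector of values of [g] may be zero and then represents no point of
     the plane; the factor [g 0] discards these parameters. *)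
  have: G p * g 0 = 0.
    apply: bipoly_eq0 => x r; rewrite rmorphM /=.
    have [->|gx] := eqVneq (bipoly_eval x r (g 0)) 0; first by rewrite mulr0.
    have := p0 (\row_i bipoly_eval x r (g i)).
    rewrite evG /meval.
    rewrite (@eq_mmap _ _ _ _ idfun _ (fun i => bipoly_eval x r (g i))) //.
      move=> ->; rewrite ?mul0r //; apply: contraNneq gx => /matrixP /(_ 0 0).
      by rewrite !mxE => ->.
    by move=> i; rewrite mxE.
  by move/eqP; rewrite mulf_eq0 (negPf (gN0 0)) orbF.
exists theta; split=> [a|i k].
  have := thetaE 0%N a%:MP 1; rewrite !rmorph1 !divr1 !mmapC.
  apply; rewrite ?oner_eq0 ?dhomog1 //.
  by rewrite -[a%:MP]mulr1 mul_mpolyC rpredZ ?dhomog1.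
have := thetaE 1%N 'X_i 'X_k (homX i) (homX k).
by rewrite !mmapX !mmap1U !mxE; apply.
Qed.

(** * Squares and roots in a fraction field, examined at the place 0 *)

(** With [w = P / Q] reduced at 0, evaluate [P ^+ 2 = Q ^+ 2 * f] at 0: if [Q] vanished there, so
    would [P]. *)
Lemma sqr_fraction_at0 (D : idomainType) (w : {fraction {poly D}})
    (f : {poly D}) :
  w ^+ 2 = tofrac f -> exists p q : D, q != 0 /\ p ^+ 2 = q ^+ 2 * f.[0].
Proof.
have [P [Q [QN0 -> coP]]] := fraction_reduced w.
have QFN0 : tofrac Q != 0 by rewrite tofrac_eq0.
rewrite expr_div_n => /(canRL (divfK (expf_neq0 2 QFN0))).
rewrite -!tofracXn -tofracM => /eqP; rewrite tofrac_eq => /eqP eqPQ.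
have := congr1 (horner^~ 0) eqPQ.
rewrite /= [in RHS]hornerM !horner_exp [RHS]mulrC => e.
exists P.[0], Q.[0]; split=> //; apply/eqP => Q0.
move/eqP: e; rewrite Q0 expr0n mul0r expf_eq0 => /eqP /coP.
by rewrite Q0 eqxx.
Qed.

(** Eisenstein's argument at the prime ['X]: for a root [P / Q] reduced at 0, ['X] divides [P];
    dividing the cleared equation by ['X] then shows that it divides [Q] too. *)
Lemma eisenstein_cubic_no_root (D : idomainType) (a b c d : {poly D})
    (w : {fraction {poly D}}) :
  a.[0] != 0 -> d.[0] != 0 ->
  tofrac a * w ^+ 3 + tofrac ('X * b) * w ^+ 2 + tofrac ('X * c) * w
    + tofrac ('X * d) != 0.
Proof.
move=> aN0 dN0; have [P [Q [QN0 -> coP]]] := fraction_reduced w.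
apply/eqP => e0.
have {e0} : a * P ^+ 3 + 'X * b * P ^+ 2 * Q + 'X * c * P * Q ^+ 2
    + 'X * d * Q ^+ 3 = 0.
  have clear (F : fieldType) (A B E G p q : F) : q != 0 ->
      A * (p / q) ^+ 3 + B * (p / q) ^+ 2 + E * (p / q) + G = 0 ->
      A * p ^+ 3 + B * p ^+ 2 * q + E * p * q ^+ 2 + G * q ^+ 3 = 0.
    move=> qN0; move/(congr1 ( *%R (q ^+ 3))); rewrite mulr0 => <-.
    by field.
  apply/eqP; rewrite -tofrac_eq0; apply/eqP.
  rewrite -[RHS](clear _ _ _ _ _ _ _ _ e0).
    by rewrite !(tofracD, tofracM, tofracXn).
  by rewrite tofrac_eq0.
move=> e0; have P0 : P.[0] = 0.
  have := congr1 (horner^~ 0) e0; rewrite !hornerE /= ?mul0r ?addr0.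
  by move/eqP; rewrite !mulf_eq0 (negPf aN0) /= !orbb => /eqP.
have /factor_theorem [P'] : root P 0 by apply/eqP.
rewrite subr0 => eP; rewrite eP in e0.
have {e0} e1 : 'X * (a * P' ^+ 3 * 'X ^+ 2 + b * P' ^+ 2 * Q * 'X ^+ 2
    + c * P' * Q ^+ 2 * 'X + d * Q ^+ 3) = 0.
  by rewrite -[RHS]e0; ring.
move/eqP: e1; rewrite mulf_eq0 polyX_eq0 /= => /eqP e1.
have := congr1 (horner^~ 0) e1; rewrite !hornerE /= => /eqP.
rewrite !(mulr0, add0r) !mulf_eq0 (negPf dN0) /= !orbb => /eqP Q0.
by move: (coP P0); rewrite Q0 eqxx.
Qed.

(** The quadratic factor is palindromic, so its roots are [r] and [r^-1]. If they differ, [r] has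
    odd multiplicity on the right and even multiplicity on the left. Otherwise [r] is 1 or -1,
    giving [n = 0] or [n = - 27]. *)
Lemma sqr_cube_quadratic (C : numClosedFieldType) (h p q : {poly C})
    (n : C) :
  h != 0 -> q != 0 ->
  p ^+ 2 = q ^+ 2 * (h ^+ 2 * ((4 * n) *: 'X - 27 *: ('X - 1) ^+ 2)) ^+ 3 ->
  n = 0 \/ n = - 27.
Proof.
move=> hN0 qN0 e.
have [r] : exists r : C, root (27 *: 'X^2 - (54 + 4 * n) *: 'X + 27%:P) r.
  apply/closed_rootP; apply/eqP => sz1.
  have : (27 *: 'X^2 - (54 + 4 * n) *: 'X + 27%:P : {poly C})`_2 = 0.
    by rewrite nth_default // sz1.
  rewrite coefD coefB !coefZ coefXn coefX coefC /= mulr1 mulr0 subr0 addr0.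
  by move/eqP; rewrite pnatr_eq0.
rewrite /root !(hornerD, hornerN, hornerZ, hornerXn, hornerX, hornerC).
move=> /eqP r0.
have rN0 : r != 0.
  apply/eqP => r_eq0; move/eqP: r0; rewrite r_eq0 expr0n /= !mulr0 subr0 add0r.
  by rewrite pnatr_eq0.
have eqn : 4 * n = 27 * (r + r^-1) - 54.
  apply: (mulIf rN0); apply/eqP; rewrite eq_sym -subr_eq0 -r0; apply/eqP.
  by field.
have [rr|rr] := eqVneq r r^-1.
  have : (r - 1) * (r + 1) = 0.
    by rewrite -subr_sqr expr1n expr2 {2}rr divff ?subrr.
  move/eqP; rewrite mulf_eq0 subr_eq0 addr_eq0.
  have n4 : (4 : C) != 0 by rewrite pnatr_eq0.
  by case/orP => /eqP r1; move: eqn; rewrite r1 ?invrN invr1 => eqn;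
    [left | right]; apply: (mulfI n4); rewrite eqn; ring.
exfalso.
have ef : (4 * n) *: 'X - 27 *: ('X - 1) ^+ 2
    = (-27) *: (('X - r%:P) * ('X - r^-1%:P)) :> {poly C}.
  have rrV : r%:P * r^-1%:P - 1 = 0 :> {poly C} by rewrite -polyCM divff ?subrr.
  rewrite eqn -!mul_polyC !(polyCB, polyCD, polyCN, polyCM, polyC_natr).
  by apply/eqP; rewrite -subr_eq0 -(mulr0 27) -rrV; apply/eqP; ring.
have C27 : (-27 : C) != 0 by rewrite oppr_eq0 pnatr_eq0.
have f0 : ('X - r%:P) * ('X - r^-1%:P) != 0 by rewrite mulf_neq0 ?polyXsubC_eq0.
have pN0 : p != 0.
  have: p ^+ 2 != 0; last by rewrite expf_eq0.
  by rewrite e ef !(mulf_neq0, expf_neq0) // scaler_eq0 negb_or C27.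
move/(congr1 (fun s => odd (mup r s))): e; rewrite ef.
have mup2 (s : {poly C}) : s != 0 -> odd (mup r (s ^+ 2)) = false.
  by move=> sN0; rewrite expr2 mupM // oddD addbb.
(* Splitting off a square leaves one copy of the quadratic, in which [r] is a simple root. *)
have -> : q ^+ 2 * (h ^+ 2 * (-27 *: (('X - r%:P) * ('X - r^-1%:P)))) ^+ 3 =
  (q * (h ^+ 3 * (-27 *: (('X - r%:P) * ('X - r^-1%:P))))) ^+ 2
   * ((-27 *: ('X - r^-1%:P)) * ('X - r%:P)) by rewrite -!mul_polyC; ring.
rewrite mup2 // mupM ?mulf_neq0 ?expf_neq0 ?mulf_neq0 ?expf_neq0 //
  ?scaler_eq0 ?negb_or ?C27 ?polyXsubC_eq0 //.
rewrite oddD mup2 ?mulf_neq0 ?expf_neq0 ?scaler_eq0 ?negb_or ?C27 //.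
rewrite mupMr ?(mup_XsubCX 1) ?eqxx //.
rewrite /root hornerZ hornerXsubC mulf_neq0 // subr_eq0 //.
Qed.

(** * The cubic of a fibre and its discriminant *)

Lemma size_cubic (F : fieldType) (a b c d : F) :
  a != 0 -> size (a *: 'X^3 + b *: 'X^2 + c *: 'X + d%:P) = 4.
Proof.
move=> aN0; rewrite -!addrA size_polyDl ?size_scale ?size_polyXn //.
rewrite (leq_ltn_trans (size_polyD _ _)) // gtn_max.
rewrite (leq_ltn_trans (size_scale_leq _ _)) ?size_polyXn //=.
rewrite (leq_ltn_trans (size_polyD _ _)) // gtn_max.
rewrite (leq_ltn_trans (size_scale_leq _ _)) ?size_polyX //=.
by rewrite (leq_ltn_trans (size_polyC_leq1 _)).
Qed.

Definition cubic_disc (R : comNzRingType) (a b c d : R) : R :=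
  b ^+ 2 * c ^+ 2 - 4 * a * c ^+ 3 - 4 * b ^+ 3 * d - 27 * a ^+ 2 * d ^+ 2
    + 18 * a * b * c * d.

(* In the affine coordinates [u, v] of the second curve, the fibre over [(s, t)]
   is cut out by [u^2 + v + u v^2 + m u v = 0] and
   [t^2 u^2 + s^2 t v + s u v^2 + l s t u v = 0]; subtracting [s] times the
   first from the second leaves [v (b + c u) = a u^2], with [a], [b], [c] the
   following expressions. *)
Definition elim_a (R : comNzRingType) (s t : R) : R := s - t ^+ 2.
Definition elim_b (R : comNzRingType) (s t : R) : R := s * (s * t - 1).
Definition elim_c (R : comNzRingType) (l m s t : R) : R := s * (l * t - m).

(* Substituting [v = a u^2 / (b + c u)] in the first equation gives
   [(b + c u)^2 + a (b + c u) + a^2 u^3 + m a u (b + c u) = 0]. *)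
Definition fibre_coef3 (R : comNzRingType) (a : R) : R := a ^+ 2.
Definition fibre_coef2 (R : comNzRingType) (m a c : R) : R :=
  c ^+ 2 + m * a * c.
Definition fibre_coef1 (R : comNzRingType) (m a b c : R) : R :=
  2 * b * c + a * c + m * a * b.
Definition fibre_coef0 (R : comNzRingType) (a b : R) : R := b ^+ 2 + a * b.

Definition abc_disc (R : comNzRingType) (m a b c : R) : R :=
  cubic_disc (fibre_coef3 a) (fibre_coef2 m a c) (fibre_coef1 m a b c)
    (fibre_coef0 a b).

Definition fibre_disc (R : comNzRingType) (l m s t : R) : R :=
  abc_disc m (elim_a s t) (elim_b s t) (elim_c l m s t).

Definition fibre_cubic (R : comNzRingType) (l m s t : R) : {poly R} :=
  let a := elim_a s t in let b := elim_b s t in let c := elim_c l m s t in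
  fibre_coef3 a *: 'X^3 + fibre_coef2 m a c *: 'X^2
    + fibre_coef1 m a b c *: 'X + (fibre_coef0 a b)%:P.

(* [fibre_disc] at [(s, t) = (1/e, x e)] and at [(s, t) = (1/(e^2 x), 1/e)],
   rescaled so as to have no pole at [e = 0]. *)
Definition disc_infinity1 (R : comNzRingType) (l m e x : R) : R :=
  abc_disc m (1 - x ^+ 2 * e ^+ 3) (x - 1) (l * x * e - m).

Definition disc_infinity2 (R : comNzRingType) (l m e x : R) : R :=
  let a := 1 - x in let b := 1 - e ^+ 3 * x in let c := l - m * e in
  cubic_disc (a ^+ 2) (x * (c ^+ 2 + m * e * a * c))
    (x * (2 * b * c + x * e ^+ 3 * a * c + m * e * a * b))
    (x * (b ^+ 2 + x * e ^+ 3 * a * b)).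

(** * Compatibility of these expressions with ring morphisms *)

Section Morphism.

Variables (R S : comNzRingType) (r : {rmorphism R -> S}).

Lemma rmorph_elim_a s t : r (elim_a s t) = elim_a (r s) (r t).
Proof. by rewrite rmorphB rmorphXn. Qed.

Lemma rmorph_elim_b s t : r (elim_b s t) = elim_b (r s) (r t).
Proof. by rewrite rmorphM rmorphB rmorphM rmorph1. Qed.

Lemma rmorph_elim_c l m s t :
  r (elim_c l m s t) = elim_c (r l) (r m) (r s) (r t).
Proof.
by rewrite /elim_c ?(rmorph_nat, rmorphXn, rmorphM, rmorphD, rmorphN).
Qed.

Lemma rmorph_fibre_coef3 a : r (fibre_coef3 a) = fibre_coef3 (r a).
Proof. by rewrite rmorphXn. Qed.

Lemma rmorph_fibre_coef2 m a c :
  r (fibre_coef2 m a c) = fibre_coef2 (r m) (r a) (r c).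
Proof.
by rewrite /fibre_coef2 ?(rmorph_nat, rmorphXn, rmorphM, rmorphD, rmorphN).
Qed.

Lemma rmorph_fibre_coef1 m a b c :
  r (fibre_coef1 m a b c) = fibre_coef1 (r m) (r a) (r b) (r c).
Proof.
by rewrite /fibre_coef1 ?(rmorph_nat, rmorphXn, rmorphM, rmorphD, rmorphN).
Qed.

Lemma rmorph_fibre_coef0 a b : r (fibre_coef0 a b) = fibre_coef0 (r a) (r b).
Proof.
by rewrite /fibre_coef0 ?(rmorph_nat, rmorphXn, rmorphM, rmorphD, rmorphN).
Qed.

Lemma rmorph_cubic_disc a b c d :
  r (cubic_disc a b c d) = cubic_disc (r a) (r b) (r c) (r d).
Proof.
by rewrite /cubic_disc ?(rmorph_nat, rmorphXn, rmorphM, rmorphD, rmorphN).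
Qed.

Lemma rmorph_abc_disc m a b c :
  r (abc_disc m a b c) = abc_disc (r m) (r a) (r b) (r c).
Proof.
rewrite rmorph_cubic_disc rmorph_fibre_coef3 rmorph_fibre_coef2.
by rewrite rmorph_fibre_coef1 rmorph_fibre_coef0.
Qed.

Lemma rmorph_fibre_disc l m s t :
  r (fibre_disc l m s t) = fibre_disc (r l) (r m) (r s) (r t).
Proof.
by rewrite rmorph_abc_disc rmorph_elim_a rmorph_elim_b rmorph_elim_c.
Qed.

Lemma rmorph_disc_infinity1 l m e x :
  r (disc_infinity1 l m e x) = disc_infinity1 (r l) (r m) (r e) (r x).
Proof.
rewrite rmorph_abc_disc; congr abc_disc.
all: by rewrite ?(rmorph1, rmorphXn, rmorphM, rmorphD, rmorphN).
Qed.

Lemma rmorph_disc_infinity2 l m e x :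
  r (disc_infinity2 l m e x) = disc_infinity2 (r l) (r m) (r e) (r x).
Proof.
rewrite rmorph_cubic_disc; congr cubic_disc.
all: by rewrite ?(rmorph1, rmorph_nat, rmorphXn, rmorphM, rmorphD, rmorphN).
Qed.

Lemma map_fibre_cubic l m s t :
  map_poly r (fibre_cubic l m s t) = fibre_cubic (r l) (r m) (r s) (r t).
Proof.
rewrite /fibre_cubic 3!(rmorphD (map_poly r)) /= map_polyC !map_polyZ map_polyX.
rewrite !map_polyXn /= rmorph_fibre_coef3 rmorph_fibre_coef2.
rewrite rmorph_fibre_coef1 rmorph_fibre_coef0.
by rewrite rmorph_elim_a rmorph_elim_b rmorph_elim_c.
Qed.

End Morphism.

Lemma horner_fibre_cubic (R : comNzRingType) (l m s t z : R) :
  let a := elim_a s t in let b := elim_b s t in let c := elim_c l m s t in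
  (fibre_cubic l m s t).[z]
    = fibre_coef3 a * z ^+ 3 + fibre_coef2 m a c * z ^+ 2
      + fibre_coef1 m a b c * z + fibre_coef0 a b.
Proof. by rewrite !(hornerD, hornerZ, hornerXn, hornerX, hornerC). Qed.

(** Here [u] rescales the equation and [v] its roots; the discriminant has degree 4 in the
    coefficients and degree 6 in the roots. *)
Lemma cubic_disc_scale (R : comNzRingType) (u v a b c d : R) :
  cubic_disc (u * a) (u * v * b) (u * v ^+ 2 * c) (u * v ^+ 3 * d)
    = u ^+ 4 * v ^+ 6 * cubic_disc a b c d.
Proof. by rewrite /cubic_disc; ring. Qed.

Lemma disc_infinity1E (F : fieldType) (l m e x : F) : e != 0 ->
  disc_infinity1 l m e x = e ^+ 8 * fibre_disc l m e^-1 (x * e).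
Proof.
(* Multiplying each of [elim_a], [elim_b], [elim_c] by [e] clears its pole, and the coefficients are
   quadratic in them: the equation is scaled by [e ^+ 2], the roots by 1. *)
move=> eN0; have -> : e ^+ 8 = (e ^+ 2) ^+ 4 * 1 ^+ 6 by ring.
rewrite -cubic_disc_scale; congr cubic_disc.
all: rewrite /fibre_coef3 /fibre_coef2 /fibre_coef1 /fibre_coef0.
all: rewrite /elim_a /elim_b /elim_c.
all: by field.
Qed.

Lemma disc_infinity2E (F : fieldType) (l m e x : F) : e != 0 -> x != 0 ->
  disc_infinity2 l m e x
    = (x ^+ 7 * e ^+ 14) ^+ 2 * fibre_disc l m (e ^+ 2 * x)^-1 e^-1.
Proof.
(* The poles now have different orders: [x ^+ 2 * e ^+ 4] clears the leading coefficient, and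
   rescaling the roots by [x * e ^+ 2] clears the others. *)
move=> eN0 xN0; have -> : (x ^+ 7 * e ^+ 14) ^+ 2
  = (x ^+ 2 * e ^+ 4) ^+ 4 * (x * e ^+ 2) ^+ 6 by ring.
rewrite -cubic_disc_scale; congr cubic_disc.
all: rewrite /fibre_coef3 /fibre_coef2 /fibre_coef1 /fibre_coef0.
all: rewrite /elim_a /elim_b /elim_c.
all: by field; rewrite xN0 eN0.
Qed.

Lemma forall_ord3 (P : 'I_3 -> Prop) : P 0 -> P 1 -> P 2 -> forall i, P i.
Proof.
by move=> P0 P1 P2 [[|[|[|//]]] lti]; [move: P0|move: P1|move: P2];
  congr P; apply: val_inj.
Qed.

(** * The fibre cubic over the function field of the plane *)

Section PlaneFunctionField.

Variables (C : numClosedFieldType) (K : fieldType).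
Variables (iota : {rmorphism C -> K}) (y : 'rV[K]_3).
Hypothesis hK : is_function_field (@is_homog C 3) (@plane C) iota y.
Let s := y 0 0 / y 0 2.
Let t := y 0 1 / y 0 2.


Let bipoly_evalX (x r : C) : bipoly_eval x r 'X = r.
Proof. by rewrite /bipoly_eval /= /horner_eval hornerX hornerC. Qed.

Let bipoly_evalCX (x r : C) : bipoly_eval x r 'X%:P = x.
Proof. by rewrite /bipoly_eval /= /horner_eval hornerC hornerX. Qed.

Let bipoly_evalE := (bipoly_evalX, bipoly_evalCX).

Lemma specialize_origin :
  exists theta : {rmorphism K -> {fraction {poly {poly C}}}},
  [/\ forall a, theta (iota a) = tofrac a%:P%:P, theta s = tofrac 'X
    & theta t = tofrac 'X%:P].
Proof.
pose g (i : 'I_3) : {poly {poly C}} := nth 0 [:: 'X; 'X%:P; 1] i.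
have [v vN0|theta [thC thE]] := plane_specialization hK (g := g).
  exists (v 1 / v 2), (v 0 / v 2), (v 2)^-1; split; first by rewrite invr_eq0.
  apply: forall_ord3; rewrite /g /= ?rmorph1 ?bipoly_evalE.
  - exact: mulrC.
  - exact: mulrC.
  - by rewrite mulVf.
by exists theta; split=> //; rewrite thE /g /= tofrac1 divr1.
Qed.

Lemma elim_a_neq0 : elim_a s t != 0.
Proof.
have [theta [_ ths tht]] := specialize_origin.
rewrite -(fmorph_eq0 theta) rmorph_elim_a ths tht /elim_a -tofracXn -tofracB.
rewrite tofrac_eq0 -rmorphXn /=; apply/eqP => /(congr1 (horner^~ 0)) /eqP.
by rewrite hornerD hornerN hornerX hornerC sub0r horner0 oppr_eq0 expf_eq0
  polyX_eq0.
Qed.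

Lemma size_fibre_cubic l m : size (fibre_cubic l m s t) = 4.
Proof.
by apply: size_cubic; rewrite expf_neq0 ?elim_a_neq0.
Qed.

(** Eisenstein at [s = 0], with [s] the outer variable: [elim_b] and [elim_c] are multiples of [s],
    so [s] divides all coefficients but the leading one, and divides the constant one exactly once.
    A cubic without roots is irreducible. *)
Lemma fibre_cubic_irreducible l m :
  irreducible_poly (fibre_cubic (iota l) (iota m) s t).
Proof.
have [theta [thC ths tht]] := specialize_origin.
apply: cubic_irreducible => [|w]; first by rewrite size_fibre_cubic.
rewrite /root -(fmorph_eq0 theta).
have -> : theta (fibre_cubic (iota l) (iota m) s t).[w] =
    (fibre_cubic (theta (iota l)) (theta (iota m)) (theta s)
      (theta t)).[theta w].
  by rewrite -map_fibre_cubic horner_map.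
rewrite ths tht !thC; move: (theta w) => z.
pose X : {poly {poly C}} := 'X%:P.
(* Below, [b'] and [c'] are [elim_b] and [elim_c] divided by [s]. *)
pose L : {poly {poly C}} := l%:P%:P; pose M : {poly {poly C}} := m%:P%:P.
pose a' := elim_a 'X X; pose b' := 'X * X - 1; pose c' := L * X - M.
rewrite horner_fibre_cubic -rmorph_elim_a -rmorph_elim_b -rmorph_elim_c.
rewrite -rmorph_fibre_coef3 -rmorph_fibre_coef2.
rewrite -rmorph_fibre_coef1 -rmorph_fibre_coef0.
have -> : fibre_coef2 M a' (elim_c L M 'X X)
    = 'X * ('X * c' ^+ 2 + M * a' * c').
  by rewrite /fibre_coef2 /a' /elim_a /elim_c /c'; ring.
have -> : fibre_coef1 M a' (elim_b 'X X) (elim_c L M 'X X)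
    = 'X * (2 * 'X * b' * c' + a' * c' + M * a' * b').
  by rewrite /fibre_coef1 /a' /elim_a /elim_b /elim_c /c' /b'; ring.
have -> : fibre_coef0 a' (elim_b 'X X) = 'X * (b' * ('X * b' + a')).
  by rewrite /fibre_coef0 /a' /elim_a /elim_b /b'; ring.
have a'0 : a'.[0] = - 'X ^+ 2.
  by rewrite /a' /elim_a /X hornerD hornerN hornerX -rmorphXn hornerC sub0r.
apply: eisenstein_cubic_no_root.
  rewrite /fibre_coef3 horner_exp a'0 !expf_neq0 //.
  by rewrite oppr_eq0 expf_neq0 ?polyX_eq0.
have b'0 : b'.[0] = -1.
  by rewrite /b' hornerD hornerN hornerC hornerM hornerX mul0r sub0r.
rewrite hornerM b'0 (hornerD ('X * b')) hornerM hornerX mul0r add0r a'0.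
rewrite mulrNN mul1r.
by rewrite expf_neq0 ?polyX_eq0.
Qed.

(** With [e] the outer and [x] the inner variable, the point [[1 : x e^2 : e]] runs along the conic
    [s t = x] and tends to [[1 : 0 : 0]] as [e] tends to 0. *)
Lemma specialize_infinity1 :
  exists theta : {rmorphism K -> {fraction {poly {poly C}}}},
  [/\ forall a, theta (iota a) = tofrac a%:P%:P,
      theta s = (tofrac 'X)^-1 & theta t = tofrac 'X%:P * tofrac 'X].
Proof.
pose g (i : 'I_3) : {poly {poly C}} := nth 0 [:: 1; 'X%:P * 'X^2; 'X] i.
have [v vN0|theta [thC thE]] := plane_specialization hK (g := g).
  exists (v 1 * v 0 / v 2 ^+ 2), (v 2 / v 0), (v 0)^-1.
  split; first by rewrite invr_eq0.
  apply: forall_ord3; rewrite /g /= ?rmorph1 ?rmorphM ?rmorphXn /=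
    ?bipoly_evalE.
  - by rewrite mulVf.
  - by field; rewrite !vN0.
  - exact: mulrC.
have XN0 : tofrac 'X != 0 :> {fraction {poly {poly C}}}.
  by rewrite tofrac_eq0 polyX_eq0.
exists theta; split=> //; rewrite thE /g /=; first by rewrite tofrac1 mul1r.
by rewrite tofracM tofracXn expr2 mulrA mulfK.
Qed.

(** The point [[1 : e x : e^2 x]] also tends to [[1 : 0 : 0]], but along the conic [t^2 = x s]. *)
Lemma specialize_infinity2 :
  exists theta : {rmorphism K -> {fraction {poly {poly C}}}},
  [/\ forall a, theta (iota a) = tofrac a%:P%:P,
      theta s = (tofrac 'X ^+ 2 * tofrac 'X%:P)^-1 & theta t = (tofrac 'X)^-1].
Proof.
pose g (i : 'I_3) : {poly {poly C}} :=
  nth 0 [:: 1; 'X * 'X%:P; 'X^2 * 'X%:P] i.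
have [v vN0|theta [thC thE]] := plane_specialization hK (g := g).
  exists (v 1 ^+ 2 / (v 0 * v 2)), (v 2 / v 1), (v 0)^-1.
  split; first by rewrite invr_eq0.
  apply: forall_ord3; rewrite /g /= ?rmorph1 ?rmorphM ?rmorphXn /=
    ?bipoly_evalE.
  - by rewrite mulVf.
  - by field; rewrite !vN0.
  - by field; rewrite !vN0.
have XN0 : tofrac 'X != 0 :> {fraction {poly {poly C}}}.
  by rewrite tofrac_eq0 polyX_eq0.
have XPN0 : tofrac 'X%:P != 0 :> {fraction {poly {poly C}}}.
  by rewrite tofrac_eq0 polyC_eq0 polyX_eq0.
exists theta; split=> //; rewrite thE /g /= !(tofracXn, tofracM).
  by rewrite tofrac1 mul1r.
have simpl (F : fieldType) (x z : F) : x != 0 -> z != 0 ->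
    x * z / (x ^+ 2 * z) = x^-1.
  by move=> xN0 zN0; field; rewrite xN0 zN0.
by rewrite (simpl {fraction {poly {poly C}}} _ _ XN0 XPN0).
Qed.

(** At [e = 0] the parameter [l] drops out of [disc_infinity1], as it occurs there only in the
    product [l * x * e]. *)
Lemma sqr_fibre_disc_mu l m b :
  b ^+ 2 = fibre_disc (iota l) (iota m) s t ^+ 3 -> m ^+ 3 = 0 \/ m ^+ 3 = - 27.
Proof.
have [theta [thC ths tht]] := specialize_infinity1.
move=> /(congr1 theta); rewrite !rmorphXn rmorph_fibre_disc ths tht !thC => e.
have XN0 : tofrac 'X != 0 :> {fraction {poly {poly C}}}.
  by rewrite tofrac_eq0 polyX_eq0.
pose f : {poly {poly C}} := disc_infinity1 l%:P%:P m%:P%:P 'X 'X%:P.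
(* The factor [e ^+ 12] is a square root of the cube of the rescaling factor [e ^+ 8]. *)
have : (tofrac 'X ^+ 12 * theta b) ^+ 2 = tofrac (f ^+ 3).
  rewrite tofracXn rmorph_disc_infinity1 /= (disc_infinity1E _ _ _ XN0).
  by rewrite exprMn e [RHS]exprMn -!exprM.
move=> /sqr_fraction_at0 [p [q [qN0]]]; rewrite horner_exp.
have -> : f.[0] = 'X ^+ 2 * ((4 * m ^+ 3) *: 'X - 27 *: ('X - 1) ^+ 2).
  rewrite -[LHS]/(horner_eval 0 f) rmorph_disc_infinity1 /= /horner_eval.
  rewrite !hornerC hornerX -!mul_polyC polyCM rmorphXn !polyC_natr /=.
  rewrite /disc_infinity1 /abc_disc /cubic_disc.
  by rewrite /fibre_coef3 /fibre_coef2 /fibre_coef1 /fibre_coef0; ring.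
by apply: sqr_cube_quadratic => //; rewrite polyX_eq0.
Qed.

(** In the second direction the roles are exchanged: [m] occurs only multiplied by [e], so [l] alone
    survives at [e = 0]. *)
Lemma sqr_fibre_disc_lam l m b :
  b ^+ 2 = fibre_disc (iota l) (iota m) s t ^+ 3 -> l ^+ 3 = 0 \/ l ^+ 3 = - 27.
Proof.
have [theta [thC ths tht]] := specialize_infinity2.
move=> /(congr1 theta); rewrite !rmorphXn rmorph_fibre_disc ths tht !thC => e.
have XN0 : tofrac 'X != 0 :> {fraction {poly {poly C}}}.
  by rewrite tofrac_eq0 polyX_eq0.
have XPN0 : tofrac 'X%:P != 0 :> {fraction {poly {poly C}}}.
  by rewrite tofrac_eq0 polyC_eq0 polyX_eq0.
pose f : {poly {poly C}} := disc_infinity2 l%:P%:P m%:P%:P 'X 'X%:P.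
have : ((tofrac 'X%:P ^+ 7 * tofrac 'X ^+ 14) ^+ 3 * theta b) ^+ 2
    = tofrac (f ^+ 3).
  rewrite tofracXn rmorph_disc_infinity2 /= (disc_infinity2E _ _ XN0 XPN0).
  by rewrite exprMn e [RHS]exprMn -!exprM.
move=> /sqr_fraction_at0 [p [q [qN0]]]; rewrite horner_exp.
have -> : f.[0] = ('X * ('X - 1)) ^+ 2
    * ((4 * l ^+ 3) *: 'X - 27 *: ('X - 1) ^+ 2).
  rewrite -[LHS]/(horner_eval 0 f) rmorph_disc_infinity2 /= /horner_eval.
  rewrite !hornerC hornerX -!mul_polyC polyCM rmorphXn !polyC_natr /=.
  by rewrite /disc_infinity2 /cubic_disc; ring.
apply: sqr_cube_quadratic => //.
by rewrite mulf_neq0 ?polyX_eq0 // polyXsubC_eq0.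
Qed.

End PlaneFunctionField.

(** * The extension generated by a root of an irreducible polynomial *)

Section IrreducibleRoot.

Variables (K L : fieldType) (phi : {rmorphism K -> L}).
Variables (c : {poly K}) (u : L).
Hypotheses (irr_c : irreducible_poly c) (cu0 : root (map_poly phi c) u).

Lemma coprimep_irreducible_root q :
  ~~ root (map_poly phi q) u -> coprimep c q.
Proof.
apply: contraNT => /(irr_c.2 _)/(_ (dvdp_gcdl _ _)) eq_gcd.
have : c %| q by rewrite -(eqp_dvdl _ eq_gcd) dvdp_gcdr.
by move=> /dvdpP [r ->]; rewrite rmorphM rootM cu0 orbT.
Qed.

Lemma irreducible_dvdp_root q : root (map_poly phi q) u -> c %| q.
Proof.
move=> qu0; have : ~~ coprimep c q.
  rewrite -(coprimep_map phi); apply/negP => /coprimep_root /(_ cu0).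
  by rewrite -rootE qu0.
move=> /(irr_c.2 _)/(_ (dvdp_gcdl _ _)) eq_gcd.
by rewrite -(eqp_dvdl _ eq_gcd) dvdp_gcdr.
Qed.

Definition adjoin_root (a : L) : Prop := exists p, a = (map_poly phi p).[u].

Lemma adjoin_root_base k : adjoin_root (phi k).
Proof. by exists k%:P; rewrite map_polyC hornerC. Qed.

Lemma adjoin_root_gen : adjoin_root u.
Proof. by exists 'X; rewrite map_polyX hornerX. Qed.

Lemma adjoin_rootD a b : adjoin_root a -> adjoin_root b -> adjoin_root (a + b).
Proof. by move=> [p ->] [q ->]; exists (p + q); rewrite rmorphD hornerD. Qed.

Lemma adjoin_rootM a b : adjoin_root a -> adjoin_root b -> adjoin_root (a * b).
Proof. by move=> [p ->] [q ->]; exists (p * q); rewrite rmorphM hornerM. Qed.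

Lemma adjoin_rootX a n : adjoin_root a -> adjoin_root (a ^+ n).
Proof. by move=> [p ->]; exists (p ^+ n); rewrite rmorphXn horner_exp. Qed.

(** A polynomial [q] not vanishing at [u] is coprime to [c], and a Bezout relation evaluated at [u]
    inverts its value. Thus the ring generated by [u] over [K] is a field. *)
Lemma adjoin_rootV a : adjoin_root a -> adjoin_root a^-1.
Proof.
move=> [q ->]; have [q0|qN0] := eqVneq (map_poly phi q).[u] 0.
  by rewrite q0 invr0 -(rmorph0 phi); apply: adjoin_root_base.
have /Bezout_eq1_coprimepP [[v w] /= e] := coprimep_irreducible_root qN0.
exists w; apply: (mulIf qN0); rewrite mulVf // -hornerM -rmorphM /=.
have := congr1 (fun r => (map_poly phi r).[u]) e.
rewrite rmorphD !rmorphM /= hornerD !hornerM (eqP cu0) mulr0 add0r.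
by rewrite rmorph1 hornerC.
Qed.

Lemma adjoin_root_mmap (C : fieldType) n (iota : {rmorphism C -> L})
    (w : 'I_n -> L) (p : {mpoly C[n]}) :
  (forall a, adjoin_root (iota a)) -> (forall i, adjoin_root (w i)) ->
  adjoin_root (mmap iota w p).
Proof.
move=> hC hw; rewrite /mmap.
have a0 : adjoin_root 0 by rewrite -(rmorph0 phi); apply: adjoin_root_base.
have a1 : adjoin_root 1 by rewrite -(rmorph1 phi); apply: adjoin_root_base.
apply: (big_ind adjoin_root) => [//|a b|m _]; first exact: adjoin_rootD.
apply: adjoin_rootM => //; rewrite /mmap1.
apply: (big_ind adjoin_root) => [//|a b|i _]; first exact: adjoin_rootM.
exact: adjoin_rootX.
Qed.

End IrreducibleRoot.

(** A square root is [k ^+ 2] times the product of the differences of the roots, [k] being the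
    leading coefficient. *)
Lemma split_cubic_disc_sqr (F : fieldType) (a b c d : F) (rs : seq F) :
  a != 0 ->
  a *: 'X^3 + b *: 'X^2 + c *: 'X + d%:P %= \prod_(r <- rs) ('X - r%:P) ->
  exists e, e ^+ 2 = cubic_disc a b c d.
Proof.
move=> aN0 e.
have := eqp_size e; rewrite size_cubic // size_prod_XsubC => -[].
case: rs e => [|r [|s [|t [|]]]] // /eqpP [[k1 k2] /= /andP [k1N0 k2N0] e] _.
rewrite !big_cons big_nil mulr1 in e.
pose k := k2 / k1.
have {}e : a *: 'X^3 + b *: 'X^2 + c *: 'X + d%:P = k *: 'X^3
    + (- k * (r + s + t)) *: 'X^2 + (k * (r * s + r * t + s * t)) *: 'X
    + (- k * r * s * t)%:P.
  apply: (scalerI k1N0); rewrite e.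
  have -> : k2 = k1 * k by rewrite mulrC divfK.
  by rewrite -!mul_polyC !(polyCN, polyCM, polyCD); ring.
have coefs i := congr1 (fun p : {poly F} => p`_i) e.
move: (coefs 0%N) (coefs 1%N) (coefs 2%N) (coefs 3%N).
rewrite !coefD !coefZ !coefXn !coefX !coefC /=.
rewrite !(mulr0, mulr1, add0r, addr0) => -> -> -> ->.
exists (k ^+ 2 * ((r - s) * (r - t) * (s - t))).
by rewrite /cubic_disc; ring.
Qed.

(** * Bihomogeneous forms *)

Section Bihomogeneous.

Variables (F : fieldType) (m n : nat).
Implicit Types p q : {mpoly F[m + n]}.

Lemma is_bihomogD de p q :
  is_bihomog de p -> is_bihomog de q -> is_bihomog de (p + q).
Proof.
move=> hp hq mon /msuppD_le; rewrite mem_cat => /orP [/hp|/hq] //.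
Qed.

Lemma is_bihomogM d e d' e' p q :
  is_bihomog (d, e) p -> is_bihomog (d', e') q ->
  is_bihomog ((d + d')%N, (e + e')%N) (p * q).
Proof.
move=> hp hq mon /msuppM_le /allpairsP [[m1 m2] /=].
move=> [/hp [h1 h2] /hq [h3 h4] ->].
split; under eq_bigr do rewrite mnmDE; rewrite big_split /=;
  by [rewrite h1 h3|rewrite h2 h4].
Qed.

Lemma is_bihomogC a : is_bihomog (0%N, 0%N) (a%:MP : {mpoly F[m + n]}).
Proof.
move=> mon; rewrite msuppC; case: eqP => // _; rewrite inE => /eqP ->.
by split; apply: big1 => i _; rewrite mnm0E.
Qed.

Lemma is_bihomogXl i :
  is_bihomog (1%N, 0%N) ('X_(lshift n i) : {mpoly F[m + n]}).
Proof.
move=> mon; rewrite msuppX inE => /eqP ->; split.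
  rewrite (bigD1 i) //= big1 ?mnm1E ?eqxx // => j ji.
  by rewrite mnm1E (inj_eq (@lshift_inj _ _)) eq_sym (negPf ji).
by apply: big1 => j _; rewrite mnm1E eq_lrshift.
Qed.

Lemma is_bihomogXr j :
  is_bihomog (0%N, 1%N) ('X_(rshift m j) : {mpoly F[m + n]}).
Proof.
move=> mon; rewrite msuppX inE => /eqP ->; split.
  by apply: big1 => i _; rewrite mnm1E eq_rlshift.
rewrite (bigD1 j) //= big1 ?mnm1E ?eqxx // => i ij.
by rewrite mnm1E (inj_eq (@rshift_inj _ _)) eq_sym (negPf ij).
Qed.

Lemma mmap_bihomog_scale (L : fieldType) (f : F -> L) (h h' : 'I_(m + n) -> L)
    (a b : L) de p :
  (forall i, h (lshift n i) = a * h' (lshift n i)) ->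
  (forall j, h (rshift m j) = b * h' (rshift m j)) ->
  is_bihomog de p -> mmap f h p = a ^+ de.1 * b ^+ de.2 * mmap f h' p.
Proof.
move=> hl hr hp; rewrite /mmap mulr_sumr; apply: eq_big_seq => mon /hp [<- <-].
rewrite mulrCA; congr (_ * _); rewrite /mmap1 !big_split_ord /= mulrACA.
rewrite -!prodrXr -!big_split; congr (_ * _); apply: eq_bigr => i _.
  by rewrite hl exprMn.
by rewrite hr exprMn.
Qed.

End Bihomogeneous.

(** * The exchange of two coordinates, and points on the cubics *)

Lemma opp_I3 : ((- 0 : 'I_3) = 0) * ((- 1 : 'I_3) = 2) * ((- 2 : 'I_3) = 1).
Proof. by split; [split|]; apply: val_inj. Qed.

(** Exchanging the coordinates 1 and 2, that is, negating indices modulo 3, carries one equation to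
    the other. It fixes the origin [[1 : 0 : 0]] and moves [[0 : 1 : 0]] to [[0 : 0 : 1]], so it is
    not constant. *)
Lemma isogenous_swap (F : fieldType) (l : F) : isogenous (cubic1 l) (cubic2 l).
Proof.
pose swap (v : 'rV[F]_3) : 'rV[F]_3 := \row_i v 0 (- i).
have swap_neq0 v : v != 0 -> swap v != 0.
  apply: contraNneq => /matrixP sv0; apply/eqP/matrixP => i j.
  by have := sv0 0 (- j); rewrite !mxE opprK (ord1 i).
have dN0 i : delta_mx 0 i != 0 :> 'rV[F]_3.
  by apply/eqP => /matrixP /(_ 0 i) /eqP; rewrite !mxE !eqxx oner_eq0.
have cubic1_delta i : i != 2 -> cubic1 l (delta_mx 0 i).
  move=> iN2; split=> //; rewrite !mxE !eqxx /=.
  by move: iN2; move: i; apply: forall_ord3 => // _ /=;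
    rewrite ?expr0n /= ?(mulr0, mul0r, addr0).
have cubic_swap v : cubic1 l v -> cubic2 l (swap v).
  move=> [vN0 e]; split; first exact: swap_neq0.
  by rewrite !mxE !opp_I3 -[RHS]e; ring.
exists (delta_mx 0 0), (swap (delta_mx 0 0)), swap.
have E0 := cubic1_delta 0 isT; have E1 := cubic1_delta 1 isT.
split=> //; first exact: cubic_swap.
split; [split=> // P [PN0 _]| |].
- exists 1%N, (fun i => 'X_(- i)).
  have gE Q : poly_map (fun i => 'X_(- i)) Q = swap Q.
    by apply/matrixP => i j; rewrite !mxE mevalXU.
  split=> [i||Q _ _]; first by rewrite dhomogX /= mdeg1.
    by rewrite gE swap_neq0.
  by rewrite gE; exists 1; rewrite ?oner_eq0 ?scale1r.
- by exists 1; rewrite ?oner_eq0 ?scale1r.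
exists (delta_mx 0 1) => // -[c _ /matrixP /(_ 0 2) /eqP].
by rewrite !mxE !opp_I3 !eqxx /= mulr0 oner_eq0.
Qed.

(** At [[r : 1 : 1]] both equations become [r^2 + (1 + l) r + 1 = 0], whose constant term forces [r]
    to be nonzero. Such points show that no coordinate vanishes identically on the curves. *)
Lemma cubic_points (C : closedFieldType) (l : C) :
  exists v : 'rV[C]_3, [/\ cubic1 l v, cubic2 l v & forall i, v 0 i != 0].
Proof.
have [r] : exists r : C, root ('X^2 + (1 + l) *: 'X + 1%:P) r.
  apply/closed_rootP; apply/eqP => sz1.
  have : ('X^2 + (1 + l) *: 'X + 1%:P : {poly C})`_2 = 0.
    by rewrite nth_default // sz1.
  rewrite !coefD coefZ coefXn coefX coefC /= mulr0 !addr0.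
  by move/eqP; rewrite oner_eq0.
rewrite /root !(hornerD, hornerZ, hornerXn, hornerX, hornerC) => /eqP r0.
have rN0 : r != 0.
  apply/eqP => r_eq0; move/eqP: r0; rewrite r_eq0 expr0n /= mulr0 !add0r.
  by rewrite oner_eq0.
pose v : 'rV[C]_3 := \row_i nth 0 [:: r; 1; 1] i.
have vN0 i : v 0 i != 0.
  by move: i; apply: forall_ord3; rewrite mxE //= oner_eq0.
have vneq0 : v != 0 by apply: contraNneq (vN0 0) => ->; rewrite mxE.
by exists v; split=> //; split=> //; rewrite !mxE /= -[RHS]r0; ring.
Qed.

(** * The generic point of the product of the two curves *)

Section AbelianSurface.

Variables (C : closedFieldType) (lam mu : C).
Variables (L : fieldType) (iota : {rmorphism C -> L}) (xz : 'rV[L]_(3 + 3)).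
Hypothesis hL : is_function_field (@is_bihomog C 3 3)
  (product (cubic1 lam) (cubic2 mu)) iota xz.

Let x (i : 'I_3) : L := xz 0 (lshift 3 i).
Let z (i : 'I_3) : L := xz 0 (rshift 3 i).

Lemma generic_coord_neq0 k : xz 0 k != 0.
Proof.
apply/eqP => xk0.
have [v [v1 _ vN0]] := cubic_points lam; have [w [_ w2 wN0]] := cubic_points mu.
pose p : {mpoly C[3 + 3]} := 'X_k.
have [d hp] : exists d, is_bihomog d p.
  rewrite /p; case: (fintype.splitP k) => i ki.
    have -> : k = lshift 3 i by apply: val_inj.
    by exists (1%N, 0%N); apply: is_bihomogXl.
  have -> : k = rshift 3 i by apply: val_inj.
  by exists (0%N, 1%N); apply: is_bihomogXr.
have p0 : mmap iota (xz 0) p = 0 by rewrite mmapX mmap1U.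
have := (hL.1 d p hp).1 p0 (row_mx v w); rewrite mevalXU => e.
have : row_mx v w 0 k = 0 by apply: e; rewrite /product row_mxKl row_mxKr.
rewrite mxE; case: splitP => i _ /eqP.
  by rewrite (negPf (vN0 i)).
by rewrite (negPf (wN0 i)).
Qed.

Lemma generic_cubic1 : x 0 ^+ 2 * x 1 + x 1 ^+ 2 * x 2 + x 2 ^+ 2 * x 0
  + iota lam * x 0 * x 1 * x 2 = 0.
Proof.
pose X i : {mpoly C[3 + 3]} := 'X_(lshift 3 i).
have hX i : is_bihomog (1%N, 0%N) (X i) by apply: is_bihomogXl.
pose p := X 0 * X 0 * X 1 + X 1 * X 1 * X 2 + X 2 * X 2 * X 0
  + lam%:MP * X 0 * X 1 * X 2.
have hp : is_bihomog (3%N, 0%N) p.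
  do 3?apply: is_bihomogD.
  - exact: is_bihomogM (is_bihomogM (hX 0) (hX 0)) (hX 1).
  - exact: is_bihomogM (is_bihomogM (hX 1) (hX 1)) (hX 2).
  - exact: is_bihomogM (is_bihomogM (hX 2) (hX 2)) (hX 0).
  have hC : is_bihomog (0%N, 0%N) (lam%:MP : {mpoly C[3 + 3]}).
    exact: is_bihomogC.
  exact: is_bihomogM (is_bihomogM (is_bihomogM hC (hX 0)) (hX 1)) (hX 2).
have : mmap iota (xz 0) p = 0.
  apply/(hL.1 _ _ hp) => v [[_ e] _].
  rewrite /p !(mevalD, mevalM, mevalC, mevalXU).
  by move: e; rewrite !mxE !expr2.
rewrite /p !(mmapD, rmorphM) /= mmapC !mmapX !mmap1U => e.
by rewrite !expr2.
Qed.

Lemma generic_cubic2 : z 0 ^+ 2 * z 2 + z 2 ^+ 2 * z 1 + z 1 ^+ 2 * z 0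
  + iota mu * z 0 * z 1 * z 2 = 0.
Proof.
pose Z i : {mpoly C[3 + 3]} := 'X_(rshift 3 i).
have hZ i : is_bihomog (0%N, 1%N) (Z i) by apply: is_bihomogXr.
pose p := Z 0 * Z 0 * Z 2 + Z 2 * Z 2 * Z 1 + Z 1 * Z 1 * Z 0
  + mu%:MP * Z 0 * Z 1 * Z 2.
have hp : is_bihomog (0%N, 3%N) p.
  do 3?apply: is_bihomogD.
  - exact: is_bihomogM (is_bihomogM (hZ 0) (hZ 0)) (hZ 2).
  - exact: is_bihomogM (is_bihomogM (hZ 2) (hZ 2)) (hZ 1).
  - exact: is_bihomogM (is_bihomogM (hZ 1) (hZ 1)) (hZ 0).
  have hC : is_bihomog (0%N, 0%N) (mu%:MP : {mpoly C[3 + 3]}).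
    exact: is_bihomogC.
  exact: is_bihomogM (is_bihomogM (is_bihomogM hC (hZ 0)) (hZ 1)) (hZ 2).
have : mmap iota (xz 0) p = 0.
  apply/(hL.1 _ _ hp) => v [_ [_ e]].
  rewrite /p !(mevalD, mevalM, mevalC, mevalXU).
  by move: e; rewrite !mxE !expr2.
rewrite /p !(mmapD, rmorphM) /= mmapC !mmapX !mmap1U => e.
by rewrite !expr2.
Qed.

End AbelianSurface.

(** * Elimination in the fibre *)

Section Elimination.

Variables (F : fieldType) (l m a b u v : F).
Hypothesis E1 : a ^+ 2 * b + b ^+ 2 + a + l * a * b = 0.
Hypothesis E2 : u ^+ 2 + v + v ^+ 2 * u + m * u * v = 0.
Let s := a * u.
Let t := b * v.

Lemma fibre_elimination :
  v * (elim_b s t + elim_c l m s t * u) = elim_a s t * u ^+ 2.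
Proof.
apply/eqP; rewrite -subr_eq0; apply/eqP.
(* Substituting [a = s / u] and [b = t / v], the first summand is the equation of the first curve
   with denominators cleared. *)
transitivity (u ^+ 2 * v ^+ 2 * (a ^+ 2 * b + b ^+ 2 + a + l * a * b)
  - a * u * (u ^+ 2 + v + v ^+ 2 * u + m * u * v)).
  by rewrite /elim_a /elim_b /elim_c /s /t; ring.
by rewrite E1 E2 !mulr0 subrr.
Qed.

(** Multiply the second equation by [(B + D * u) ^+ 2] and replace [v * (B + D * u)] by
    [A * u ^+ 2]: the result is [u ^+ 2] times the cubic. *)
Lemma root_fibre_cubic : u != 0 -> root (fibre_cubic l m s t) u.
Proof.
move=> uN0; apply/eqP; apply: (mulfI (expf_neq0 2 uN0)); rewrite mulr0.
rewrite horner_fibre_cubic; cbv zeta; have := fibre_elimination.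
set A := elim_a s t; set B := elim_b s t; set D := elim_c l m s t => h.
transitivity ((B + D * u) ^+ 2 * u ^+ 2 + (B + D * u) * (A * u ^+ 2)
  + u * (A * u ^+ 2) ^+ 2 + m * u * (B + D * u) * (A * u ^+ 2)).
  by rewrite /fibre_coef3 /fibre_coef2 /fibre_coef1 /fibre_coef0; ring.
transitivity ((B + D * u) ^+ 2 * (u ^+ 2 + v + v ^+ 2 * u + m * u * v)).
  by rewrite -h; ring.
by rewrite E2 mulr0.
Qed.

End Elimination.

(** * A Galois extension forces both parameters to vanish *)

Theorem proposition3p2 (R : realType) (lam mu : R[i])
    (hlam : lam ^+ 3 != - 27%:R) (hmu : mu ^+ 3 != - 27%:R)
    (hiso : ~ isogenous (cubic1 lam) (cubic2 mu))
    (K : fieldType) (iotaK : {rmorphism R[i] -> K}) (y : 'rV[K]_3)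
    (hK : is_function_field (@is_homog R[i] 3) (@plane R[i]) iotaK y)
    (L : fieldType) (iotaL : {rmorphism R[i] -> L}) (xz : 'rV[L]_(3 + 3))
    (hL : is_function_field (@is_bihomog R[i] 3 3)
            (product (cubic1 lam) (cubic2 mu)) iotaL xz)
    (fpull : {rmorphism K -> L})
    (hf : is_pullback iotaK y iotaL xz fpull) :
  ~ galois_ext fpull.
Proof.
move=> [_ [_ normal]]; apply: hiso.
pose x (i : 'I_3) := xz 0 (lshift 3 i); pose z (i : 'I_3) := xz 0 (rshift 3 i).
have xN0 i : x i != 0 := generic_coord_neq0 hL _.
have zN0 i : z i != 0 := generic_coord_neq0 hL _.
pose a := x 0 / x 2; pose b := x 1 / x 2.
pose u := z 0 / z 2; pose v := z 1 / z 2.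
pose s := y 0 0 / y 0 2; pose t := y 0 1 / y 0 2.
have E1 : a ^+ 2 * b + b ^+ 2 + a + iotaL lam * a * b = 0.
  have := generic_cubic1 hL; rewrite -/(x _) -/(x 1) -/(x 2) => e.
  apply: (mulfI (expf_neq0 3 (xN0 2))); rewrite mulr0 -[RHS]e /a /b.
  by field; rewrite xN0.
have E2 : u ^+ 2 + v + v ^+ 2 * u + iotaL mu * u * v = 0.
  have := generic_cubic2 hL; rewrite -/(z _) -/(z 1) -/(z 2) => e.
  apply: (mulfI (expf_neq0 3 (zN0 2))); rewrite mulr0 -[RHS]e /u /v.
  by field; rewrite zN0.
have uN0 : u != 0 by rewrite mulf_neq0 ?invr_eq0.
have vN0 : v != 0 by rewrite mulf_neq0 ?invr_eq0.
have homX i : ('X_i : {mpoly R[i][3]}) \is 1.-homog by rewrite dhomogX /= mdeg1.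
have fC k : fpull (iotaK k) = iotaL k.
  have := hf 0%N k%:MP 1; rewrite !rmorph1 !divr1 !mmapC; apply.
  - by rewrite -[k%:MP]mulr1 mul_mpolyC rpredZ ?dhomog1.
  - exact: dhomog1.
  exact: oner_neq0.
(* Were it zero, the convention [0^-1 = 0] would give [s = t = 0], hence [elim_a s t = 0]. *)
have yN0 : y 0 2 != 0.
  apply: contraNneq (elim_a_neq0 hK) => y20.
  by rewrite /elim_a y20 invr0 !mulr0 expr0n subrr.
have fy i : fpull (y 0 i / y 0 2) = x i * z i / (x 2 * z 2).
  have := hf 1%N 'X_i 'X_2 (homX i) (homX 2); rewrite !mmapX !mmap1U !mxE.
  by move=> ->.
have fs : fpull s = a * u by rewrite fy mulf_div.
have ft : fpull t = b * v by rewrite fy mulf_div.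
pose c := fibre_cubic (iotaK lam) (iotaK mu) s t.
have fc : map_poly fpull c = fibre_cubic (iotaL lam) (iotaL mu) (a * u) (b * v).
  by rewrite map_fibre_cubic fs ft !fC.
have irr_c : irreducible_poly c by exact: fibre_cubic_irreducible hK _ _.
have cu0 : root (map_poly fpull c) u by rewrite fc root_fibre_cubic.
have aN0 : elim_a (a * u) (b * v) != 0.
  by rewrite -fs -ft -rmorph_elim_a fmorph_eq0; exact: elim_a_neq0 hK.
(* The next steps show that [S] is all of [L], so that [u] generates [L] over [K]. *)
pose S := adjoin_root fpull u.
have Su : S u := adjoin_root_gen _ _.
have SK k : S (fpull k) := adjoin_root_base _ _ k.
have SM p q : S p -> S q -> S (p * q) by apply: adjoin_rootM.
have SV p : S p -> S p^-1 := adjoin_rootV irr_c cu0 (a := p).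
(* The relation [v * d = elim_a * u ^+ 2] determines [v], since a zero [d] would make its right-hand
   side vanish. *)
have Sv : S v.
  set d := elim_b (a * u) (b * v)
    + elim_c (iotaL lam) (iotaL mu) (a * u) (b * v) * u.
  have e : v * d = elim_a (a * u) (b * v) * u ^+ 2 := fibre_elimination E1 E2.
  have dN0 : d != 0.
    apply/eqP => d0; move/eqP: e; rewrite d0 mulr0 eq_sym mulf_eq0 expf_eq0.
    by rewrite (negPf aN0) (negPf uN0).
  rewrite -[v](mulfK dN0) e; apply: (SM); first apply: (SM).
  - by rewrite -fs -ft -rmorph_elim_a; apply: SK.
  - exact: adjoin_rootX.
  apply: (SV); rewrite /d -fs -ft -!fC -rmorph_elim_b -rmorph_elim_c.
  exact: adjoin_rootD (SK _) (SM _ _ (SK _) Su).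
have Sa : S a by rewrite -[a](mulfK uN0) -fs; apply/SM/SV.
have Sb : S b by rewrite -[b](mulfK vN0) -ft; apply/SM/SV.
have S1 : S 1 by rewrite -(rmorph1 fpull); apply: (SK).
pose w (i : 'I_(3 + 3)) : L := match split i with
  | inl j => x j / x 2 | inr j => z j / z 2 end.
have Sw i : S (w i).
  rewrite /w; case: split; apply: forall_ord3 => //.
    by rewrite divff.
  by rewrite divff.
have Smmap p : S (mmap iotaL w p).
  by apply: adjoin_root_mmap => // k; rewrite -fC; apply: SK.
(* Numerator and denominator have the same bidegree, so passing to the affine coordinates [w]
   multiplies both by the same factor. *)
have Sall e : S e.
  have [de [p [q [hp hq qN0 ->]]]] := hL.2 e.
  have scale r : is_bihomog de r ->
      mmap iotaL (xz 0) r = x 2 ^+ de.1 * z 2 ^+ de.2 * mmap iotaL w r.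
    apply: mmap_bihomog_scale => i; rewrite /w.
      by rewrite (unsplitK (inl i)) mulrC divfK.
    by rewrite (unsplitK (inr i)) mulrC divfK.
  rewrite (scale p hp) (scale q hq) -mulf_div divff ?mul1r; last first.
    by rewrite mulf_neq0 ?expf_neq0.
  by apply: (SM) => //; apply: (SV).
(* Normality splits [c] over [L], so its discriminant has a square root [dl] there. Writing [dl] as
   a polynomial in [u] and taking the norm of degree 3 makes the cube of the discriminant a square
   in [K]. *)
have [rs splits] := normal u c irr_c cu0.
have [dl dlE] :
  exists e, e ^+ 2 = fpull (fibre_disc (iotaK lam) (iotaK mu) s t).
  rewrite rmorph_fibre_disc fs ft !fC; apply: split_cubic_disc_sqr.
    exact: expf_neq0 2 aN0.
  by move: splits; rewrite fc; apply.
have [p pE] := Sall dl.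
have /(sqr_eq_expn_of_dvdp (size_fibre_cubic hK _ _)) [N NE] :
    c %| p ^+ 2 - (fibre_disc (iotaK lam) (iotaK mu) s t)%:P.
  apply: (irreducible_dvdp_root irr_c cu0).
  rewrite rmorphB rmorphXn /= map_polyC /root hornerD hornerN hornerC.
  by rewrite horner_exp -pE dlE subrr.
have l0 : lam = 0.
  have [/eqP|/eqP e] := sqr_fibre_disc_lam hK NE; last by rewrite e in hlam.
  by rewrite expf_eq0 => /eqP.
have m0 : mu = 0.
  have [/eqP|/eqP e] := sqr_fibre_disc_mu hK NE; last by rewrite e in hmu.
  by rewrite expf_eq0 => /eqP.
by rewrite l0 m0; apply: isogenous_swap.
Qed.
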